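(* Let $(X,G)$ be a complete $G$-metric space with $|X|\geq 3$. Let $T: X\to X$ be a mapping satisfying the following conditions: (I) for all $x\in X$, $T(Tx)\neq x$ provided $Tx\neq x$; (II) there exists $\lambda\in (0,1)$ such that for all pairwise distinct points $x,y,z\in X$, $$G(Tx,Ty,Tz)\leq \lambda\, G(x,y,z).$$ Then $\operatorname{Fix}(T)\neq\emptyset$ and $|\operatorname{Fix}(T)|\leq 2$.
   Context: $X$ is a nonempty set, $|X|$ denotes its cardinality, and $\operatorname{Fix}(T)=\{x\in X: Tx=x\}$. Write $\mathbb{R}^+=[0,\infty)$. A mapping $G: X\times X\times X\to \mathbb{R}^+$ is a $G$-metric on $X$, and $(X,G)$ is a $G$-metric space, if for all $x,y,z,w\in X$: (P1) $G(x,y,z)=0$ if and only if $x=y=z$; (P2) if $x\neq y$, then $G(x,x,y)>0$; (P3) $G$ is invariant under every permutation of its three arguments; (P4) if $y\neq z$, then $G(x,x,y)\leq G(x,y,z)$; (P5) $G(x,y,z)\leq G(x,w,w)+G(w,y,z)$. A sequence $\{x_n\}$ in $X$ is $G$-convergent to $x\in X$ if $\lim_{n,m\to\infty}G(x_n,x_m,x)=0$. It is $G$-Cauchy if $\lim_{n,m\to\infty}G(x_n,x_m,x_m)=0$. $(X,G)$ is complete if every $G$-Cauchy sequence in $X$ is $G$-convergent to an element of $X$. *)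

(* Defs.v *)
From mathcomp Require Import all_boot all_order all_algebra.
From mathcomp Require Import all_classical all_reals all_analysis.

Set Implicit Arguments.
Unset Strict Implicit.
Unset Printing Implicit Defensive.

Import Order.TTheory GRing.Theory Num.Theory.
Import numFieldNormedType.Exports.

Local Open Scope classical_set_scope.
Local Open Scope ring_scope.

Record is_G_metric (R : realType) (X : Type) (G : X -> X -> X -> R) : Prop := {
  G_ge0 : forall x y z, 0 <= G x y z;
  G_eq0 : forall x y z, G x y z = 0 <-> x = y /\ y = z;
  G_gt0 : forall x y, x <> y -> 0 < G x x y;
  G_perm : forall x y z,
    [/\ G x z y = G x y z, G y x z = G x y z, G y z x = G x y z,
        G z x y = G x y z & G z y x = G x y z];
  G_le : forall x y z, y <> z -> G x x y <= G x y z;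
  G_rectangle : forall x y z w, G x y z <= G x w w + G w y z
}.

(* The limits below are double limits: the filter on [nat * nat] is the product
   of the filter of neighbourhoods of infinity with itself. *)
Definition G_cvg (R : realType) (X : Type) (G : X -> X -> X -> R)
    (u : nat -> X) (x : X) : Prop :=
  (fun p : nat * nat => G (u p.1) (u p.2) x) @ filter_prod \oo \oo --> (0 : R).

Definition G_cauchy (R : realType) (X : Type) (G : X -> X -> X -> R)
    (u : nat -> X) : Prop :=
  (fun p : nat * nat => G (u p.1) (u p.2) (u p.2)) @ filter_prod \oo \oo
    --> (0 : R).

Definition G_complete (R : realType) (X : Type) (G : X -> X -> X -> R) : Prop :=
  forall u : nat -> X, G_cauchy G u -> exists x : X, G_cvg G u x.

Definition Fix (X : Type) (T : X -> X) : set X := [set x | T x = x].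

(* Main.v *)
Require Import Defs.
From mathcomp Require Import all_boot all_order all_algebra.
From mathcomp Require Import all_classical all_reals all_analysis.
From mathcomp Require Import ring lra.

Local Open Scope classical_set_scope.
Local Open Scope card_scope.
Local Open Scope ring_scope.

Import Order.TTheory GRing.Theory Num.Theory.
Import numFieldNormedType.Exports.

(** The argument is Picard iteration, made delicate by the fact that the
    contraction inequality is only available on triples of distinct points.

    Suppose that [T] has no fixed point. Together with the absence of 2-cycles
    this makes [x], [T x], [T (T x)] pairwise distinct for every [x], so the
    contraction applies along the whole orbit: [h x = G x (T x) (T (T x))] is
    positive and [h (T x) <= lambda * h x]. This has two consequences. First,
    the terms [G (u n) (u n.+1) (u n.+1)] of the orbit [u] are dominated by a
    geometric sequence, so [u] is Cauchy ([G_cauchy_geometric]) and converges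
    to some [x]. Secondly [h] strictly decreases along [u], hence [u] is
    injective ([orbit_inj]). Injectivity means that [u] eventually avoids any
    given point, in particular [x] and [T x]; the contraction therefore applies
    to [u n], [u n.+1], [x] for large [n], and this forces [T x = x]
    ([limit_of_injective_orbit]), a contradiction.

    Three distinct fixed points would form a triple on which the contraction
    reads [g <= lambda * g] with [0 < g], which is impossible since
    [lambda < 1]; thus there are at most two of them. *)

(** * Two-point estimates in a G-metric space *)

(** [G x x y] and [G x y y] both play the role of a distance between [x] and
    [y]; they differ in general, but only up to a factor 2. *)
Lemma G_flip (R : realType) (X : Type) (G : X -> X -> X -> R)
    (GP : is_G_metric G) (x y : X) :
  G x y y <= 2 * G x x y.
Proof.
have := G_rectangle GP y x y x.
have [_ _ _ -> _] := G_perm GP x x y.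
have [_ -> -> _ _] := G_perm GP x y y.
lra.
Qed.

Lemma G_triple_gt0 (R : realType) (X : Type) (G : X -> X -> X -> R)
    (GP : is_G_metric G) (x y z : X) :
  x <> y -> 0 < G x y z.
Proof.
move=> xy; rewrite lt_neqAle (G_ge0 GP) andbT eq_sym.
by apply/eqP => /(G_eq0 GP)[].
Qed.

(** * Sequences with geometrically decreasing steps *)

(** The bound [a / (1 - lambda) * (lambda ^+ n - lambda ^+ (n + k))] is the
    closed form of [a * (lambda ^+ n + ... + lambda ^+ (n + k - 1))], which is
    what [k] applications of the rectangle inequality give. *)
Lemma G_telescope (R : realType) (X : Type) (G : X -> X -> X -> R)
    (GP : is_G_metric G) (u : nat -> X) (a lambda : R) (lambda1 : lambda < 1)
    (ua : forall n, G (u n) (u n.+1) (u n.+1) <= a * lambda ^+ n) (n k : nat) :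
  G (u n) (u (n + k)%N) (u (n + k)%N) <=
    a / (1 - lambda) * (lambda ^+ n - lambda ^+ (n + k)).
Proof.
elim: k => [|k IH].
  by rewrite addn0 subrr mulr0 (G_eq0 GP (u n) (u n) (u n)).2.
rewrite addnS.
apply: le_trans (G_rectangle GP _ _ _ (u (n + k)%N)) _.
apply: le_trans (lerD IH (ua (n + k)%N)) _.
have d0 : 1 - lambda != 0 by lra.
have aE : a = a / (1 - lambda) * (1 - lambda) by rewrite divfK.
rewrite {2}aE exprS.
by rewrite le_eqVlt; apply/predU1P; left; ring.
Qed.

Lemma G_cauchy_geometric (R : realType) (X : Type) (G : X -> X -> X -> R)
    (GP : is_G_metric G) (u : nat -> X) (a lambda : R)
    (lambda01 : 0 < lambda < 1) (a0 : 0 <= a)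
    (ua : forall n, G (u n) (u n.+1) (u n.+1) <= a * lambda ^+ n) :
  G_cauchy G u.
Proof.
have [l0 l1] := andP lambda01.
pose c := a / (1 - lambda).
have c0 : 0 <= c by rewrite divr_ge0 //; lra.
have dist_le n m : (n <= m)%N -> G (u n) (u m) (u m) <= c * lambda ^+ n.
  move=> nm; rewrite -(subnKC nm).
  apply: le_trans (G_telescope _ _ _ GP _ _ _ l1 ua _ _) _.
  by rewrite ler_wpM2l // gerBl exprn_ge0 // ltW.
apply/cvgr0Pnorm_lt => e e0.
have lim0 : (2 * c) * lambda ^+ n @[n --> \oo] --> (0 : R).
  rewrite -[X in _ --> X](mulr0 (2 * c)); apply: cvgMr.
  by apply: cvg_expr; rewrite gtr0_norm.
have [N _ HN] := cvgr0_norm_lt _ lim0 e e0.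
have small n m : (N <= n)%N -> (n <= m)%N -> 2 * G (u n) (u m) (u m) < e.
  move=> Nn nm; apply: le_lt_trans (HN n Nn); apply: le_trans (ler_norm _).
  by rewrite -mulrA ler_pM2l // dist_le.
exists ([set n | (N <= n)%N], [set n | (N <= n)%N]); first by split; exists N.
move=> [n m] /= [Nn Nm]; rewrite ger0_norm ?(G_ge0 GP) //.
have [nm|/ltnW mn] := leqP n m.
  apply: le_lt_trans (small _ _ Nn nm).
  by have := G_ge0 GP (u n) (u m) (u m); lra.
apply: le_lt_trans (G_flip _ _ _ GP _ _) _.
by have [_ _ _ <- _] := G_perm GP (u n) (u n) (u m); exact: small.
Qed.

(** * Maps that contract triples of distinct points *)

Definition contracts_triples (R : realType) (X : Type)
    (G : X -> X -> X -> R) (T : X -> X) (lambda : R) : Prop :=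
  forall x y z : X, x <> y -> y <> z -> x <> z ->
    G (T x) (T y) (T z) <= lambda * G x y z.

Lemma injective_seq_avoids (X : Type) (u : nat -> X) (y : X) :
  injective u -> \forall n \near \oo, u n <> y.
Proof.
move=> u_inj; have [[k uk]|nk] := pselect (exists k, u k = y).
  by exists k.+1 => // n /= kn; rewrite -uk => /u_inj nk; rewrite nk ltnn in kn.
by exists 0%N => // n _ un; apply: nk; exists n.
Qed.

(** Injectivity of the orbit is what makes the contraction usable at the limit
    point, by keeping the tail of the orbit away from it and from its image. *)
Lemma limit_of_injective_orbit (R : realType) (X : Type)
    (G : X -> X -> X -> R) (GP : is_G_metric G) (T : X -> X) (lambda : R)
    (lambda1 : lambda <= 1) (T_contr : contracts_triples R X G T lambda)
    (x0 x : X) :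
  injective (fun n => iter n T x0) -> G_cvg G (fun n => iter n T x0) x ->
  T x = x.
Proof.
set u := fun n => iter n T x0 => u_inj u_x.
suff Gxx0 : G (T x) x x <= 0.
  have /(G_eq0 GP)[//] : G (T x) x x = 0.
  by apply/eqP; rewrite eq_le Gxx0 (G_ge0 GP).
apply/ler_addgt0Pr => e e0; rewrite add0r.
have e30 : 0 < e / 3 by lra.
have [[A B] /= [Aoo Boo] AB] := cvgr0_norm_lt _ u_x _ e30.
have close n m : A n -> B m -> G (u n) (u m) x < e / 3.
  by move=> An Bm; exact: le_lt_trans (ler_norm _) (AB (n, m) (conj An Bm)).
have shift (P : set nat) : (\forall n \near \oo, P n) ->
    \forall n \near \oo, P n.+1.
  by move=> [N _ NP]; exists N => // n /= Nn; apply: NP; exact: leqW.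
have ux := injective_seq_avoids _ u x u_inj.
have uTx := injective_seq_avoids _ u (T x) u_inj.
have [n [An An1 Bn1 [unx un1x un2Tx]]] : exists n,
    [/\ A n, A n.+1, B n.+1 & [/\ u n <> x, u n.+1 <> x & u n.+2 <> T x]].
  apply: (@filter_ex _ \oo); near=> n.
  split; [near: n; exact: Aoo | near: n; exact: shift Aoo
    | near: n; exact: shift Boo | split].
  - by near: n; exact: ux.
  - by near: n; exact: shift ux.
  - by near: n; exact: shift (shift _ uTx).
have near_x : G (u n.+1) (u n.+1) x < e / 3 by exact: close.
have near_Tx : G (u n.+1) (u n.+1) (T x) < e / 3.
  apply: le_lt_trans (close _ _ An Bn1).
  apply: le_trans (G_le GP _ (nesym un2Tx)) _.
  have [-> _ _ _ _] := G_perm GP (u n.+1) (u n.+2) (T x).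
  apply: le_trans (T_contr (u n) (u n.+1) x _ un1x unx) _.
    by move/u_inj/eqP; rewrite ltn_eqF.
  by rewrite ler_piMl // (G_ge0 GP).
apply: le_trans (G_rectangle GP (T x) x x (u n.+1)) _.
have := G_flip _ _ _ GP (u n.+1) x.
have [_ _ _ -> _] := G_perm GP (u n.+1) (u n.+1) (T x).
by lra.
Unshelve. all: by end_near. Qed.

(** [h] is a strict Lyapunov function: returning to a point already visited
    would require [h] to recover a value that it has lost. *)
Lemma orbit_inj (R : realType) (X : Type) (T : X -> X) (h : X -> R)
    (h_decr : forall x, h (T x) < h x) (x0 : X) :
  injective (fun n => iter n T x0).
Proof.
have h_iter n k : h (iter (n + k).+1 T x0) < h (iter n T x0).
  elim: k => [|k IH]; first by rewrite addn0; exact: h_decr.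
  by rewrite addnS; exact: lt_trans (h_decr _) IH.
have lt_neq n m : (n < m)%N -> iter n T x0 <> iter m T x0.
  move=> nm eq_nm; have := h_iter n (m - n.+1)%N.
  by rewrite -addSn subnKC // -eq_nm ltxx.
move=> n m /= eq_nm; have [nm|mn|//] := ltngtP n m.
  by case: (lt_neq _ _ nm).
by case: (lt_neq _ _ mn).
Qed.

Lemma contracts_triples_fixpoint (R : realType) (X : Type)
    (G : X -> X -> X -> R) (GP : is_G_metric G) (complete_G : G_complete G)
    (T : X -> X) (no_2cycle : forall x, T x <> x -> T (T x) <> x) (lambda : R)
    (lambda01 : 0 < lambda < 1) (T_contr : contracts_triples R X G T lambda)
    (x0 : X) :
  Fix T !=set0.
Proof.
have [l0 l1] := andP lambda01.
have [//|noFix] := pselect (Fix T !=set0).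
have TN x : T x <> x by move=> Tx; apply: noFix; exists x.
pose h x := G x (T x) (T (T x)).
have h_contr x : h (T x) <= lambda * h x.
  by apply: T_contr => /esym; [exact: TN | exact: TN | exact/no_2cycle/TN].
have h_decr x : h (T x) < h x.
  apply: le_lt_trans (h_contr x) _; rewrite gtr_pMl //.
  by apply: G_triple_gt0 => // /esym; exact: TN.
pose u n := iter n T x0.
have h_geo n : h (u n) <= h x0 * lambda ^+ n.
  elim: n => [|n IH]; first by rewrite mulr1.
  apply: le_trans (h_contr _) _.
  by rewrite exprS mulrCA ler_pM2l.
have u_geo n : G (u n) (u n.+1) (u n.+1) <= h x0 * lambda ^+ n.
  apply: le_trans (h_geo n).
  have [_ _ <- _ _] := G_perm GP (u n) (u n.+1) (u n.+1).
  have [_ swap _ _ _] := G_perm GP (u n) (u n.+1) (u n.+2).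
  rewrite [h _](esym swap).
  by apply: (G_le GP) => /esym; exact/no_2cycle/TN.
have [x u_x] := complete_G u
  (G_cauchy_geometric _ _ _ GP _ _ _ lambda01 (G_ge0 GP _ _ _) u_geo).
exists x.
apply: (limit_of_injective_orbit _ _ _ GP _ _ (ltW l1) T_contr x0) => //.
exact: (orbit_inj _ _ _ h).
Qed.

Lemma contracts_triples_no_3fix (R : realType) (X : Type)
    (G : X -> X -> X -> R) (GP : is_G_metric G) (T : X -> X) (lambda : R)
    (lambda1 : lambda < 1) (T_contr : contracts_triples R X G T lambda)
    (a b c : X) :
  T a = a -> T b = b -> T c = c -> a <> b -> b <> c -> a <> c -> False.
Proof.
move=> Ta Tb Tc ab bc ac; have := T_contr a b c ab bc ac.
rewrite Ta Tb Tc leNgt gtr_pMl ?lambda1 //.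
exact: G_triple_gt0.
Qed.

(** * Sets with at most two elements *)

Lemma card_le2 (X : Type) (A : set X) :
  (forall a b c, A a -> A b -> A c -> a <> b -> b <> c -> a <> c -> False) ->
  A #<= `I_2.
Proof.
move=> no3.
have [/set0P[a Aa]|] := boolP (A != set0); last first.
  by move=> /negPn/eqP ->; exact: card_ge0.
suff [b Aab] : exists b, A `<=` [set a; b].
  apply: (@card_le_trans _ _ _ [set (if n == 0%N then a else b) | n in `I_2]).
    by apply: subset_card_le => x /Aab[] ->; [exists 0%N | exists 1%N].
  exact: card_image_le.
have [[b [Ab ab]]|no_b] := pselect (exists b, A b /\ a <> b).
  exists b => c Ac; have [->|ac] := pselect (a = c); first by left.
  have [->|bc] := pselect (b = c); first by right.
  by case: (no3 a b c).
exists a => c Ac; left; have [//|ac] := pselect (a = c).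
by case: no_b; exists c.
Qed.

Theorem theorem3p1 (R : realType) (X : Type) (G : X -> X -> X -> R)
    (T : X -> X)
    (G_metric : is_G_metric G)
    (complete_G : G_complete G)
    (card_X : `I_3 #<= [set: X])
    (no_2cycle : forall x : X, T x <> x -> T (T x) <> x)
    (contracts : exists lambda : R, 0 < lambda < 1 /\
       forall x y z : X, x <> y -> y <> z -> x <> z ->
         G (T x) (T y) (T z) <= lambda * G x y z) :
  Fix T !=set0 /\ Fix T #<= `I_2.
Proof.
have [lambda [lambda01 T_contr]] := contracts.
have [x0] : [set: X] !=set0.
  apply/set0P/eqP => X0; move: card_X; rewrite X0 card_le0 => /eqP/seteqP[].
  by move=> /(_ 0%N isT).
move=> _; split.
  exact: contracts_triples_fixpoint no_2cycle _ lambda01 T_contr x0.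
apply: card_le2; apply: contracts_triples_no_3fix T_contr => //.
by case/andP: lambda01.
Qed.
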